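(* With $X^o = Y = Y^o\sqcup \partial Y$, let $f \in L(Y^o)$, $g_1 \in L(\partial Y)$ and $g_2 \in L(\partial X)$. Then the boundary value problem $$\Delta^2 u = f \ \text{ on } Y^o,\quad \Delta u = g_1 \ \text{ on } \partial Y \quad\text{and}\quad u = g_2\ \text{ on }\partial X$$ has a unique solution $u\in L(X)$, which is given by $$u = G_{X^o}G_{Y^o}f - G_{X^o}h_1 + h_2,$$ where $$h_1(y) = \int_{\partial Y} g_1\, d\nu_y^{\partial Y} \quad (y \in Y) \quad\text{and}\quad h_2(x) = \int_{\partial X} g_2\, d\nu_x^{\partial X} \quad (x \in X).$$
   Context: Let $(X,E)$ be a finite directed graph with $|X|\ge2$, $E\subset X^2$ without loops, which is strongly connected. Each edge $(x,y)\in E$ carries a weight $a(x,y)>0$, and $a(x,y)=0$ if $(x,y)\notin E$. Put $m(x)=\sum_y a(x,y)$, $p(x,y)=a(x,y)/m(x)$, $P=(p(x,y))_{x,y\in X}$. $L(B)$ is the space of functions $B\to\mathbb{C}$ (column vectors), $Pu(x)=\sum_y p(x,y)u(y)$, and $\Delta=P-I$. The boundary $\partial X$ is a non-empty subset of $X$, and $X^o=X\setminus\partial X$ is non-empty. Put $Y=X^o$, $\partial Y=\{x\in Y:(x,z)\in E\text{ for some }z\in X\setminus Y\}$ and $Y^o=Y\setminus\partial Y$. For $A,B\subset X$, $P_{A,B}=(p(x,y))_{x\in A,y\in B}$ and $P_A=P_{A,A}$. For $A\subsetneq X$, $G_A=(I_A-P_A)^{-1}=\sum_{n\ge0}P_A^n$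 (the inverse exists and the series converges); $G_A$ is also viewed as a matrix over $X\times X$ with entries $0$ outside $A\times A$. For $x\in X^o$, $y\in\partial X$, $\nu_x^{\partial X}(y)$ is the $(x,y)$-entry of $G_{X^o}P_{X^o,\partial X}$, and $\nu_x^{\partial X}=\delta_x$ for $x\in\partial X$. Likewise, for $x\in Y^o$, $y\in\partial Y$, $\nu_x^{\partial Y}(y)$ is the $(x,y)$-entry of $G_{Y^o}P_{Y^o,\partial Y}$, and $\nu_x^{\partial Y}=\delta_x$ for $x\in\partial Y$. Integrals are sums: $\int_B g\,d\nu=\sum_{y\in B}g(y)\nu(y)$. *)

(* Defs.v *)
From HB Require Import structures.
From mathcomp Require Import all_boot all_order all_algebra.
From mathcomp Require Import reals.
From mathcomp Require Export complex.

Set Implicit Arguments.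
Unset Strict Implicit.
Unset Printing Implicit Defensive.

Import GRing.Theory.
Local Open Scope ring_scope.
Local Open Scope complex_scope.

(* Complex functions on the whole vertex type X, resp. on a subset B. *)
Notation fullL R X := {ffun X -> R[i]}.
Notation subL R B := {ffun {x | x \in B} -> R[i]}.

Section BoundaryValueProblem.
Variables (R : realType) (X : finType).

(* {x in Y : (x, z) in E for some z outside Y}; only outgoing edges count. *)
Definition inner_bnd (E : rel X) (Y : {set X}) : {set X} :=
  [set x in Y | [exists z, (z \notin Y) && E x z]].

Definition inner_part (E : rel X) (Y : {set X}) : {set X} := Y :\: inner_bnd E Y.

Section Weights.
Variable a : X -> X -> R.

Definition mass (x : X) : R := \sum_y a x y.

Definition trans (x y : X) : R := a x y / mass x.

Definition transop (u : fullL R X) : fullL R X :=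
  [ffun x => \sum_y (trans x y)%:C * u y].

Definition laplacian (u : fullL R X) : fullL R X := transop u - u.

(* P_A, with rows and columns indexed by the enumeration of A. *)
Definition transmx (A : {set X}) : 'M[R]_#|A| :=
  \matrix_(i, j) trans (enum_val i) (enum_val j).

(* G_A viewed as a matrix over X x X, with entries 0 outside A x A.
   When the graph is strongly connected and A is a proper subset of X, the
   matrix I - P_A is a unit, so that invmx is its actual inverse.            *)
Definition green (A : {set X}) (x y : X) : R :=
  match insub x : option {x | x \in A}, insub y : option {y | y \in A} with
  | Some x', Some y' => invmx (1%:M - transmx A)
      (enum_rank_in (valP x') x) (enum_rank_in (valP y') y)
  | _, _ => 0
  end.

Definition greenop (A : {set X}) (u : fullL R X) : fullL R X :=
  [ffun x => \sum_y (green A x y)%:C * u y].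

(* The hitting distribution nu_x of a boundary set B, where A is the interior
   belonging to B and x ranges over A and B: the row of index x of
   G_A P_{A,B} if x is in A, and the Dirac mass at x if x is in B.  Only its
   values nu_x(y) with y in B are meaningful.                                *)
Definition hitting (A : {set X}) (x y : X) : R :=
  if x \in A then \sum_(z in A) green A x z * trans z y else (x == y)%:R.

End Weights.

Definition integral (B : {set X}) (g : subL R B) (nu : X -> R) : R[i] :=
  \sum_(y : {y | y \in B}) g y * (nu (val y))%:C.

Definition ext0 (B : {set X}) (f : subL R B) : fullL R X :=
  [ffun x => oapp f 0 (insub x)].

Definition is_solution (E : rel X) (a : X -> X -> R) (dX : {set X})
    (f : subL R (inner_part E (~: dX))) (g1 : subL R (inner_bnd E (~: dX)))
    (g2 : subL R dX) (u : fullL R X) : Prop :=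
  [/\ forall x, laplacian a (laplacian a u) (val x) = f x,
      forall x, laplacian a u (val x) = g1 x
    & forall x, u (val x) = g2 x].

End BoundaryValueProblem.

(* Main.v *)
Require Import Defs.
From mathcomp Require Import all_boot all_order all_algebra.
From mathcomp Require Import reals.

Set Implicit Arguments.
Unset Strict Implicit.
Unset Printing Implicit Defensive.

Import Order.TTheory GRing.Theory Num.Theory.
Local Open Scope ring_scope.

(** The operator identities [laplacian_green] and [green_laplacian] say that,
    for a proper subset A of the vertices, - G_A is a two-sided inverse of the
    Laplacian on A acting on functions that vanish off A.  They hold because
    I - P_A is invertible, which is the maximum principle: a subharmonic function on A
    that is nonpositive off A is nonpositive, since the set where it attains a
    positive maximum would be closed under outgoing edges, hence everything.

    The hitting distributions integrate a function g on a set disjoint from A to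
    h = g + G_A P g, where g is extended by 0 ([harmonic_extE]), so that h is
    harmonic on A and equals the extended g off A.

    The biharmonic problem is solved by using this twice.  With A = Y, the
    proposed u satisfies Delta u = - G_{Y^o} f + h1 on Y.  The right-hand side
    is g1 on the inner boundary of Y, and, with A = Y^o, its Laplacian is f on
    Y^o.  This is also Delta^2 u there, because no edge leads from Y^o out of
    Y, so that the Laplacian on Y^o sees values on Y only ([laplacian_local]).

    Uniqueness follows from [dirichlet_unique] in the same order: for a solution
    d of the homogeneous problem, Delta d cut off outside Y vanishes off Y^o and
    is harmonic on Y^o, hence Delta d = 0 on Y; then d vanishes off Y and is
    harmonic on Y, hence d = 0. *)

(** * The Laplacian, Green operators and hitting distributions *)

Section Operators.
Variables (R : realType) (X : finType) (a : X -> X -> R).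
Local Open Scope complex_scope.

Lemma laplacianE (u : fullL R X) x :
  laplacian a u x = (\sum_y (trans a x y)%:C * u y) - u x.
Proof. by rewrite !ffunE. Qed.

Lemma laplacianD (u v : fullL R X) x :
  laplacian a (u + v) x = laplacian a u x + laplacian a v x.
Proof.
rewrite !laplacianE; under eq_bigr do rewrite ffunE mulrDr.
by rewrite ffunE big_split opprD addrACA.
Qed.

Lemma laplacianN (u : fullL R X) x : laplacian a (- u) x = - laplacian a u x.
Proof.
rewrite !laplacianE; under eq_bigr do rewrite ffunE mulrN.
by rewrite ffunE sumrN opprD.
Qed.

Lemma green_outl (A : {set X}) x y : x \notin A -> green a A x y = 0.
Proof. by move=> xA; rewrite /green insubN. Qed.

Lemma green_outr (A : {set X}) x y : y \notin A -> green a A x y = 0.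
Proof. by move=> yA; rewrite /green; case: insub => // x'; rewrite insubN. Qed.

Lemma green_enum (A : {set X}) (i j : 'I_#|A|) :
  green a A (enum_val i) (enum_val j) = invmx (1%:M - transmx a A) i j.
Proof.
rewrite /green (insubT (fun x => x \in A) (enum_valP i)).
by rewrite (insubT (fun x => x \in A) (enum_valP j)) /= !enum_valK_in.
Qed.

Lemma greenop_out (A : {set X}) (u : fullL R X) x :
  x \notin A -> greenop a A u x = 0.
Proof.
by move=> xA; rewrite ffunE big1 // => y _; rewrite green_outl // mul0r.
Qed.

Lemma ext0_out (B : {set X}) (g : subL R B) x : x \notin B -> ext0 g x = 0.
Proof. by move=> xB; rewrite ffunE insubN. Qed.

Lemma ext0_val (B : {set X}) (g : subL R B) x : ext0 g (val x) = g x.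
Proof. by rewrite ffunE valK. Qed.

Lemma integral_ext0 (B : {set X}) (g : subL R B) (nu : X -> R) :
  integral g nu = \sum_y ext0 g y * (nu y)%:C.
Proof.
rewrite /integral (bigID (mem B)) /= [X in _ + X]big1 ?addr0; last first.
  by move=> y yB; rewrite ext0_out // mul0r.
rewrite (@reindex_omap _ _ _ X {x | x \in B} val insub) /=; last first.
  by move=> y yB; rewrite insubT.
apply: eq_big => [x|x _]; last by rewrite ext0_val.
by rewrite valK eqxx andbT (valP x).
Qed.

(** The function h1 (for A the inner part of Y) or h2 (for A = Y) of the
    solution formula, on the whole vertex set. *)
Definition harmonic_ext (A B : {set X}) (g : subL R B) : fullL R X :=
  [ffun x => integral g (hitting a A x)].

(** For x in A the mass nu_x(y) is the (x,y)-entry of G_A P, so that integrating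
    g against nu_x applies G_A P to the extension of g by 0. *)
Lemma harmonic_extE (A B : {set X}) (g : subL R B) : [disjoint A & B] ->
  harmonic_ext A g = ext0 g + greenop a A (transop a (ext0 g)).
Proof.
move=> dAB; apply/ffunP => x; rewrite [LHS]ffunE integral_ext0 [RHS]ffunE.
rewrite /hitting; have [xA|/negPf xA] := boolP (x \in A); last first.
  rewrite greenop_out ?xA // addr0 (bigD1 x) //= eqxx mulr1 big1 ?addr0 // => y.
  by rewrite eq_sym => /negPf ->; rewrite mulr0.
rewrite ext0_out ?(disjointFr dAB) // add0r ffunE.
under [RHS]eq_bigr do rewrite ffunE mulr_sumr.
rewrite exchange_big; apply: eq_bigr => y _ /=.
rewrite rmorph_sum mulr_sumr [RHS](bigID (mem A)) /=.
rewrite [X in _ = _ + X]big1 ?addr0; last first.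
  by move=> z zA; rewrite green_outr // mul0r.
by apply: eq_bigr => z _; rewrite rmorphM mulrC mulrA.
Qed.

Lemma harmonic_ext_out (A B : {set X}) (g : subL R B) x :
  [disjoint A & B] -> x \notin A -> harmonic_ext A g x = ext0 g x.
Proof.
by move=> dAB xA; rewrite harmonic_extE // ffunE greenop_out // addr0.
Qed.

End Operators.

(** * The maximum principle and the Dirichlet problem *)

Section Network.
Variables (R : realType) (X : finType) (E : rel X) (a : X -> X -> R).
Hypotheses (X_ge2 : (2 <= #|X|)%N) (E_strong : forall x y, connect E x y).
Hypotheses (a_pos : forall x y, E x y -> 0 < a x y).
Hypotheses (a_zero : forall x y, ~~ E x y -> a x y = 0).
Local Open Scope complex_scope.

Lemma weight_ge0 x y : 0 <= a x y.
Proof. by have [/a_pos/ltW|/a_zero ->] := boolP (E x y). Qed.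

Lemma exists_edge x : exists y, E x y.
Proof.
have [z xz] : exists z, z != x.
  have : (0 < #|predC1 x|)%N.
    by have := cardC1 x; case: (#|X|) X_ge2 => [|[|n]] // _ ->.
  by case/card_gt0P => z; exists z.
case/connectP: (E_strong x z) xz => -[|y p] /= => [_ ->|/andP[Exy _] _ _].
  by rewrite eqxx.
by exists y.
Qed.

Lemma mass_gt0 x : 0 < mass a x.
Proof.
have [y Exy] := exists_edge x; rewrite /mass (bigD1 y) //=.
by rewrite ltr_pwDl ?a_pos // sumr_ge0 // => z _; apply: weight_ge0.
Qed.

Lemma trans_ge0 x y : 0 <= trans a x y.
Proof. by rewrite divr_ge0 ?weight_ge0 // ltW ?mass_gt0. Qed.

Lemma trans_gt0 x y : E x y -> 0 < trans a x y.
Proof. by move=> /a_pos axy; rewrite divr_gt0 ?mass_gt0. Qed.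

Lemma trans_eq0 x y : ~~ E x y -> trans a x y = 0.
Proof. by move=> /a_zero axy; rewrite /trans axy mul0r. Qed.

Lemma sum_trans x : \sum_y trans a x y = 1.
Proof. by rewrite -mulr_suml divff // gt_eqF ?mass_gt0. Qed.

(** Where w attains a positive maximum it is subharmonic, so that its average
    over the successors forces the same value there; strong connectivity
    spreads the maximum to a vertex outside A, where w is nonpositive. *)
Lemma maximum_principle (A : {set X}) (w : X -> R) : A != setT ->
    (forall x, x \in A -> w x <= \sum_y trans a x y * w y) ->
    (forall x, x \notin A -> w x <= 0) ->
  forall x, w x <= 0.
Proof.
move=> AT sub_w w_out x0; rewrite leNgt; apply/negP => w0.
case: (arg_maxP w (isT : predT x0)) => m _ /(_ _ isT) max_m.
have wm : 0 < w m by apply: lt_le_trans w0 (max_m _).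
have in_A x : w x = w m -> x \in A.
  by move=> wx; apply: contraLR wm => /w_out; rewrite wx leNgt.
(* The average of w over the successors of a maximum point is maximal. *)
have step x y : w x = w m -> E x y -> w y = w m.
  move=> wx Exy; have := sub_w x (in_A x wx); rewrite wx => le_sum.
  have ge0 z : true -> 0 <= trans a x z * (w m - w z).
    by move=> _; rewrite mulr_ge0 ?trans_ge0 // subr_ge0; apply: max_m.
  have sum0 : \sum_z trans a x z * (w m - w z) = 0.
    apply/le_anti; rewrite sumr_ge0 // andbT.
    under eq_bigr do rewrite mulrBr.
    by rewrite sumrB -mulr_suml sum_trans mul1r subr_le0.
  have /eqP := psumr_eq0P ge0 sum0 (i := y) isT.
  by rewrite mulf_eq0 gt_eqF ?trans_gt0 //= subr_eq0 => /eqP.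
case/negP: AT; apply/eqP/setP => y; rewrite inE; apply: in_A.
have /connectP[p] := E_strong m y.
have : w m = w m by [].
elim: p {1 3 4}m => [|z p IHp] x wx /= => [_ -> //|/andP[/step Exz]].
by apply: IHp; apply: Exz.
Qed.

(** A vector killed by I - P_A, extended by 0, is harmonic on A; the maximum
    principle applies to it and to its opposite. *)
Lemma unitmx_transmx (A : {set X}) :
  A != setT -> 1%:M - transmx a A \in unitmx.
Proof.
move=> AT; rewrite -unitmx_tr -row_free_unit; apply: inj_row_free => v Mv0.
pose w x := \sum_(i | enum_val i == x) v 0 i.
have w_val j : w (enum_val j) = v 0 j.
  by rewrite /w (big_pred1 j) // => i; rewrite (inj_eq enum_val_inj).
have w_out x : x \notin A -> w x = 0.
  move=> xA; rewrite /w big_pred0 // => i; apply: contraNF xA => /eqP <-.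
  exact: enum_valP.
have harm x : x \in A -> w x = \sum_y trans a x y * w y.
  move=> xA; rewrite -(enum_rankK_in xA xA); set j := enum_rank_in _ _.
  rewrite (bigID (mem A)) /= [X in _ + X]big1 ?addr0; last first.
    by move=> y yA; rewrite w_out // mulr0.
  rewrite big_enum_val /=.
  have /matrixP/(_ 0 j) := Mv0.
  rewrite linearB /= trmx1 mulmxBr mulmx1 !mxE => /eqP.
  rewrite subr_eq0 w_val => /eqP ->.
  by apply: eq_bigr => i _; rewrite !mxE w_val mulrC.
have le0 : forall x, w x <= 0.
  by apply: (maximum_principle AT) => x xA; [rewrite -harm | rewrite w_out].
have ge0 : forall x, - w x <= 0.
  apply: (maximum_principle AT) => x xA; last by rewrite w_out ?oppr0.
  by under eq_bigr do rewrite mulrN; rewrite sumrN -harm.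
apply/rowP => j; rewrite mxE -w_val; apply/le_anti.
by rewrite le0 -oppr_le0 ge0.
Qed.

(** The right inverse identity (I - P_A) G_A = I_A, read on the whole vertex
    set; the intermediate vertex y may range over everything because G_A
    vanishes off A. *)
Lemma trans_green (A : {set X}) x z : A != setT -> x \in A ->
  \sum_y trans a x y * green a A y z = green a A x z - (x == z)%:R.
Proof.
move=> AT xA; have [zA|zA] := boolP (z \in A); last first.
  rewrite big1 => [|y _]; last by rewrite green_outr // mulr0.
  by rewrite green_outr // (negPf (memPn zA x xA)) subr0.
rewrite (bigID (mem A)) /= [X in _ + X]big1 ?addr0; last first.
  by move=> y yA; rewrite green_outl // mulr0.
rewrite -(enum_rankK_in xA xA) -(enum_rankK_in zA zA).
set i := enum_rank_in _ _; set j := enum_rank_in _ _.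
have /matrixP/(_ i j) := mulmxV (unitmx_transmx AT).
rewrite mulmxBl mul1mx !mxE (inj_eq enum_val_inj) green_enum => <-.
rewrite opprB addrCA subrr addr0 big_enum_val /=.
by apply: eq_bigr => k _; rewrite green_enum mxE.
Qed.

(** The left inverse identity G_A (I - P_A) = I_A, read on the whole vertex
    set. *)
Lemma green_trans (A : {set X}) x z : A != setT -> z \in A ->
  \sum_y green a A x y * trans a y z = green a A x z - (x == z)%:R.
Proof.
move=> AT zA; have [xA|xA] := boolP (x \in A); last first.
  rewrite big1 => [|y _]; last by rewrite green_outl // mul0r.
  by rewrite green_outl // (negPf (memPnC xA z zA)) subr0.
rewrite (bigID (mem A)) /= [X in _ + X]big1 ?addr0; last first.
  by move=> y yA; rewrite green_outr // mul0r.
rewrite -(enum_rankK_in xA xA) -(enum_rankK_in zA zA).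
set i := enum_rank_in _ _; set j := enum_rank_in _ _.
have /matrixP/(_ i j) := mulVmx (unitmx_transmx AT).
rewrite mulmxBr mulmx1 !mxE (inj_eq enum_val_inj) green_enum => <-.
rewrite opprB addrCA subrr addr0 big_enum_val /=.
by apply: eq_bigr => k _; rewrite green_enum mxE.
Qed.

(** Gives existence in the Dirichlet problem: G_A solves the Poisson equation
    on A with value 0 off A. *)
Lemma laplacian_green (A : {set X}) (u : fullL R X) x :
  A != setT -> x \in A -> laplacian a (greenop a A u) x = - u x.
Proof.
move=> AT xA; rewrite laplacianE ffunE.
under eq_bigr do rewrite ffunE mulr_sumr.
rewrite exchange_big -sumrB /=.
transitivity (\sum_z - (x == z)%:R * u z); last first.
  rewrite (bigD1 x) //= eqxx mulN1r big1 ?addr0 // => z zx.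
  by rewrite eq_sym (negPf zx) oppr0 mul0r.
apply: eq_bigr => z _; under eq_bigr do rewrite mulrA -rmorphM.
rewrite -mulr_suml -rmorph_sum -mulrBl -rmorphB trans_green //.
by rewrite addrAC subrr add0r rmorphN rmorph_nat.
Qed.

(** Gives uniqueness in the Dirichlet problem: a function vanishing off A is
    determined by its Laplacian on A, since G_A only reads values on A. *)
Lemma green_laplacian (A : {set X}) (w : fullL R X) :
    A != setT -> (forall x, x \notin A -> w x = 0) ->
  greenop a A (laplacian a w) = - w.
Proof.
move=> AT w_out; apply/ffunP => x; rewrite !ffunE.
under eq_bigr do rewrite laplacianE mulrBr mulr_sumr.
rewrite sumrB exchange_big -sumrB /=.
transitivity (\sum_z - (x == z)%:R * w z); last first.
  rewrite (bigD1 x) //= eqxx mulN1r big1 ?addr0 // => z zx.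
  by rewrite eq_sym (negPf zx) oppr0 mul0r.
apply: eq_bigr => z _; have [zA|/w_out wz] := boolP (z \in A); last first.
  by rewrite wz !mulr0 subr0 big1 // => y _; rewrite !mulr0.
under eq_bigr do rewrite mulrA -rmorphM.
rewrite -mulr_suml -rmorph_sum -mulrBl -rmorphB green_trans //.
by rewrite addrAC subrr add0r rmorphN rmorph_nat.
Qed.

Lemma dirichlet_unique (A : {set X}) (w : fullL R X) : A != setT ->
    (forall x, x \in A -> laplacian a w x = 0) ->
    (forall x, x \notin A -> w x = 0) ->
  w = 0.
Proof.
move=> AT harm w_out; apply: oppr_inj; rewrite -(green_laplacian AT w_out).
apply/ffunP => x; rewrite oppr0 !ffunE big1 // => y _.
have [/harm ->|yA] := boolP (y \in A); first by rewrite mulr0.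
by rewrite green_outr // mul0r.
Qed.

(** On A the extension of g by 0 vanishes, so that its Laplacian is P g, and
    this is cancelled by the Laplacian of G_A P g. *)
Lemma laplacian_harmonic_ext (A B : {set X}) (g : subL R B) x :
    A != setT -> [disjoint A & B] -> x \in A ->
  laplacian a (harmonic_ext a A g) x = 0.
Proof.
move=> AT dAB xA; rewrite harmonic_extE // laplacianD laplacian_green //.
rewrite laplacianE [transop _ _ _]ffunE addrAC subrr sub0r.
by rewrite ext0_out ?oppr0 // (disjointFr dAB).
Qed.

(** A vertex with an edge out of Y belongs to the inner boundary, so that from
    the inner part of Y the random walk stays in Y for one step. *)
Lemma laplacian_local (Y : {set X}) (v w : fullL R X) x :
    {in Y, v =1 w} -> x \in inner_part E Y ->
  laplacian a v x = laplacian a w x.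
Proof.
move=> vw; rewrite !inE => /andP[+ xY]; rewrite xY /= => /existsPn noE.
rewrite !laplacianE vw //; congr (_ - _); apply: eq_bigr => y _.
have [/vw -> //|yY] := boolP (y \in Y).
by have := noE y; rewrite yY /= => /trans_eq0 ->; rewrite !mul0r.
Qed.

End Network.

(** * The biharmonic boundary value problem *)

Theorem mainTheorem10 (R : realType) (X : finType) (E : rel X)
    (a : X -> X -> R) (dX : {set X})
    (X_ge2 : (2 <= #|X|)%N)
    (E_irr : irreflexive E)
    (E_strong : forall x y, connect E x y)
    (a_pos : forall x y, E x y -> 0 < a x y)
    (a_zero : forall x y, ~~ E x y -> a x y = 0)
    (dX_neq0 : dX != set0)
    (Y_neq0 : ~: dX != set0)
    (f : subL R (inner_part E (~: dX)))
    (g1 : subL R (inner_bnd E (~: dX)))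
    (g2 : subL R dX) :
  let Y := ~: dX in
  let Yo := inner_part E Y in
  let h1 : subL R Y := [ffun y => integral g1 (hitting a Yo (val y))] in
  let h2 : fullL R X := [ffun x => integral g2 (hitting a Y x)] in
  (exists! u : fullL R X, is_solution a f g1 g2 u) /\
  is_solution a f g1 g2
    (greenop a Y (greenop a Yo (ext0 f)) - greenop a Y (ext0 h1) + h2).
Proof.
move=> Y Yo h1 h2; set u := _ + h2.
have YT : Y != setT by rewrite /Y -setC0 (inj_eq (@setC_inj X)).
have YoY : Yo \subset Y by apply: subsetDl.
have YoT : Yo != setT.
  by apply: contraNneq YT => YoE; rewrite -subTset -YoE.
have bndY : inner_bnd E Y \subset Y.
  by apply/subsetP => x; rewrite inE => /andP[].
have dY : [disjoint Y & dX] by rewrite disjoint_sym disjoints_subset setCK.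
have dYo : [disjoint Yo & inner_bnd E Y].
  by rewrite disjoints_subset; apply: subsetDr.
have Yo_or_bnd x : x \in Y -> x \notin Yo -> x \in inner_bnd E Y.
  by move=> xY; rewrite in_setD xY andbT negbK.
(* h1 is only defined on Y, but off Y the hitting distributions of the inner
   boundary are Dirac masses at points outside it, and integrate g1 to 0. *)
have h1E : ext0 h1 = harmonic_ext a Yo g1.
  apply/ffunP => x; have [xY|xY] := boolP (x \in Y).
    by rewrite -[x]/(val (exist (fun x => x \in Y) x xY)) ext0_val !ffunE.
  rewrite ext0_out // harmonic_ext_out ?ext0_out //.
    by apply: contra xY; apply: subsetP.
  by apply: contra xY; apply: subsetP.
have h2E : h2 = harmonic_ext a Y g2 by [].
pose v : fullL R X := harmonic_ext a Yo g1 - greenop a Yo (ext0 f).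
have vE x : v x = harmonic_ext a Yo g1 x - greenop a Yo (ext0 f) x.
  by rewrite !ffunE.
have lap_u : {in Y, laplacian a u =1 v}.
  move=> x xY; rewrite /u h1E h2E !laplacianD laplacianN vE.
  rewrite !(laplacian_green X_ge2 E_strong a_pos a_zero) //.
  rewrite (laplacian_harmonic_ext X_ge2 E_strong a_pos a_zero) //.
  by rewrite addr0 opprK addrC.
have sol_u : is_solution a f g1 g2 u.
  split=> x.
  - rewrite (laplacian_local a_zero lap_u) ?(valP x) //.
    rewrite /v laplacianD laplacianN.
    rewrite (laplacian_harmonic_ext X_ge2 E_strong a_pos a_zero) ?(valP x) //.
    rewrite (laplacian_green X_ge2 E_strong a_pos a_zero) ?(valP x) //.
    by rewrite sub0r opprK ext0_val.
  - rewrite lap_u ?(subsetP bndY) ?(valP x) // vE.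
    have xYo : val x \notin Yo by rewrite (disjointFl dYo) ?(valP x).
    by rewrite greenop_out // subr0 harmonic_ext_out // ext0_val.
  - have xY : val x \notin Y by rewrite (disjointFl dY) ?(valP x).
    rewrite /u ffunE [X in X + _]ffunE [X in _ + X + _]ffunE.
    rewrite !greenop_out // subr0 add0r.
    by rewrite h2E harmonic_ext_out // ext0_val.
split=> //; exists u; split=> // u' [sol1 sol2 sol3].
case: sol_u => solu1 solu2 solu3; apply/eqP; rewrite -subr_eq0; apply/eqP.
set d := u - u'.
have dE x : d x = u x - u' x by rewrite !ffunE.
have bilap0 x : x \in Yo -> laplacian a (laplacian a d) x = 0.
  move=> xYo.
  have -> : laplacian a d = laplacian a u - laplacian a u'.
    by apply/ffunP => y; rewrite laplacianD laplacianN !ffunE.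
  rewrite laplacianD laplacianN.
  by rewrite (solu1 (exist _ x xYo)) (sol1 (exist _ x xYo)) subrr.
have lap0 x : x \in inner_bnd E Y -> laplacian a d x = 0.
  move=> xB; rewrite laplacianD laplacianN.
  by rewrite (solu2 (exist _ x xB)) (sol2 (exist _ x xB)) subrr.
have d0 x : x \notin Y -> d x = 0.
  rewrite inE negbK => xB; rewrite dE.
  by rewrite (solu3 (exist _ x xB)) (sol3 (exist _ x xB)) subrr.
(* Cutting the Laplacian of d off outside Y makes it vanish off Yo, and does not
   change its own Laplacian on Yo. *)
pose w : fullL R X := [ffun x => if x \in Y then laplacian a d x else 0].
have wE : {in Y, w =1 laplacian a d} by move=> x xY; rewrite ffunE xY.
have w0 : w = 0.
  apply: (dirichlet_unique X_ge2 E_strong a_pos a_zero YoT) => x xYo.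
    by rewrite (laplacian_local a_zero wE) // bilap0.
  by rewrite ffunE; case: ifPn => // xY; rewrite lap0 // Yo_or_bnd.
apply: (dirichlet_unique X_ge2 E_strong a_pos a_zero YT) => // x xY.
by rewrite -wE // w0 ffunE.
Qed.
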